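(* Let $(x(n))_{n\in\mathbb{N}}$ be a sequence taking values in the torus $\mathbb{R}/\mathbb{Z}$. Then, for every integer $d\ge 1$, the sequence $(x(n+d)-x(n))_{n\in\mathbb{N}}$ (differences taken in $\mathbb{R}/\mathbb{Z}$) has the same entropy as $(x(n))_{n\in\mathbb{N}}$, i.e. $\mathrm{AE}\big((x(n+d)-x(n))_{n}\big)=\mathrm{AE}\big((x(n))_n\big)$ in $[0,\infty]$.
   Context: $\mathbb{N}=\{0,1,2,\dots\}$. Entropy of a sequence: let $x=(x(n))_{n\in\mathbb{N}}$ be a sequence in $K=\mathbb{R}/\mathbb{Z}$, or a bounded sequence in $K=\mathbb{C}$. Let $X_0$ be the closure of $\{x(n):n\in\mathbb{N}\}$ in $K$ (a compact space), and let $X_x$ be the closure of $\{(x(m),x(m+1),x(m+2),\dots): m\in\mathbb{N}\}$ in $X_0^{\mathbb{N}}$ with the product topology. The shift $\sigma:(\omega_0,\omega_1,\dots)\mapsto(\omega_1,\omega_2,\dots)$ maps $X_x$ continuously to itself. The (anqie) entropy of $x$, denoted $\mathrm{AE}(x)\in[0,\infty]$, is the topological entropy of $(X_x,\sigma)$: the supremum over open covers $\mathcal{U}$ of $X_x$ of $\lim_{n}\frac1n\log\mathcal{N}(\mathcal{U}\vee\sigma^{-1}\mathcal{U}\vee\cdots\vee\sigma^{-n+1}\mathcal{U})$, where $\mathcal{N}(\mathcal{W})$ is the minimal cardinality of a subcover of $\mathcal{W}$. *)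

(* Defs.v *)
From HB Require Import structures.
From mathcomp Require Import all_boot all_order all_algebra.
From mathcomp Require Import all_classical all_reals all_analysis.
Import Order.TTheory GRing.Theory Num.Theory.
Import numFieldNormedType.Exports.

Set Implicit Arguments.
Unset Strict Implicit.
Unset Printing Implicit Defensive.

Local Open Scope classical_set_scope.
Local Open Scope ring_scope.

Definition int_subgroup (R : realType) : zmodClosed R :=
  GRing.ZmodClosed.clone R (@Num.int_num_subdef R) _.

Lemma int_subgroupE (R : realType) (r : R) :
  (r \in int_subgroup R) = (r \is a Num.int).
Proof. by []. Qed.

(* R / Z, with the quotient topology and the quotient group structure. *)
Definition torus (R : realType) : Type :=
  quotient_topology (Quotient.quot (int_subgroup R)).

HB.instance Definition _ (R : realType) :=
  Topological.copy (torus R)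
    (quotient_topology (Quotient.quot (int_subgroup R))).

(* [quotient_topology] and [Quotient.quot] carry different choice structures,
   so the group structure is rebuilt from its laws instead of being copied. *)
HB.instance Definition _ (R : realType) :=
  GRing.isZmodule.Build (torus R)
    (@Quotient.addqA R (int_subgroup R)) (@Quotient.addqC R (int_subgroup R))
    (@Quotient.add0q R (int_subgroup R)) (@Quotient.addNq R (int_subgroup R)).

Section TopologicalEntropy.
Context (R : realType) (T : topologicalType).
Implicit Types (U V W : set (set T)) (f : T -> T).

Definition covering V : Prop := \bigcup_(A in V) A = [set: T].

Definition open_cover U : Prop := (forall A, U A -> open A) /\ covering U.

(* +oo when [W] has no finite subcover *)
Definition cover_number W : \bar R :=
  ereal_inf [set k%:R%:E | k in
    [set k : nat | exists V, [/\ V `<=` W, covering V & (V #= `I_k)%card]]].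

Definition cover_join U V : set (set T) :=
  [set A `&` B | A in U & B in V].

Definition cover_preimage f U : set (set T) := [set f @^-1` A | A in U].

(* U \/ f^-1 U \/ ... \/ f^-(n-1) U *)
Definition cover_iter f U (n : nat) : set (set T) :=
  \big[cover_join/[set [set: T]]]_(i < n) cover_preimage (iter i f) U.

Definition cover_entropy f U : \bar R :=
  limn (fun n => (n%:R^-1)%:E * lne (cover_number (cover_iter f U n)))%E.

Definition topological_entropy f : \bar R :=
  ereal_sup [set cover_entropy f U | U in [set U | open_cover U]].

End TopologicalEntropy.

Section OrbitClosure.
Context (K : topologicalType).

Definition seq_shift (w : {ptws nat -> K}) : {ptws nat -> K} := fun k => w k.+1.

Lemma seq_shift_continuous : continuous seq_shift.
Proof.
move=> w.
have F : Filter (seq_shift @ w) := fmap_filter seq_shift (nbhs_filter w).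
apply/cvg_sup => k U [_ [[V oV <-]] Vw VU].
apply: filterS VU _.
exact: (@proj_continuous nat (fun=> K) k.+1 w) (open_nbhs_nbhs (conj oV Vw)).
Qed.

Section Orbit.
Variable x : nat -> K.

(* X_0 *)
Definition value_closure : set K := closure (range x).

Definition value_seq (n : nat) : value_closure :=
  SigSub (mem_set (subset_closure (imageT x n))).

Definition tail_seq (m : nat) : {ptws nat -> value_closure} :=
  fun k => value_seq (m + k).

End Orbit.
End OrbitClosure.

Section AnqieEntropy.
Context (R : realType) (K : topologicalType) (x : nat -> K).

Definition orbit_closure : set {ptws nat -> value_closure x} :=
  closure (range (tail_seq x)).

Lemma orbit_closure_shift w : orbit_closure w -> orbit_closure (seq_shift w).
Proof.
move=> clw A /seq_shift_continuous /clw [_ [[m _ <-] Aw]].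
exists (tail_seq x m.+1); split; first exact: imageT.
by congr A: Aw; apply/funext => k; rewrite /seq_shift /tail_seq addSnnS.
Qed.

(* the shift of X_x *)
Definition orbit_shift (w : orbit_closure) : orbit_closure :=
  SigSub (mem_set (orbit_closure_shift (set_mem (valP w)))).

Definition AE : \bar R := topological_entropy R orbit_shift.

End AnqieEntropy.
Arguments AE R {K} x.

(* Main.v *)
(* The map sending w to the sequence w(k + d) - w(k) makes X_y, where
   y(n) = x(n + d) - x(n), a factor of X_x, so AE(y) <= AE(x).  Conversely, the
   difference of two points of a fibre of this map is a d-periodic sequence in
   R/Z, so two points of a fibre whose first d coordinates are e-close stay
   e-close forever.  Hence the fibres are covered by a number N of orbit
   cylinders that does not depend on their length m, and Bowen's argument
   (refresh the choice of cylinder every m steps) gives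
   h(U) <= AE(y) + (log N) / m for every open cover U of X_x and every m.
   The limits defining the entropies exist by Fekete's lemma. *)
Require Import Defs.
From HB Require Import structures.
From mathcomp Require Import all_boot all_order all_algebra.
From mathcomp Require Import all_classical all_reals all_analysis.
From mathcomp Require Import zify lra.
Import Order.TTheory GRing.Theory Num.Theory.
Import numFieldNormedType.Exports.

Set Implicit Arguments.
Unset Strict Implicit.
Unset Printing Implicit Defensive.

Local Open Scope classical_set_scope.
Local Open Scope ring_scope.

(** * Fekete's lemma for nonnegative subadditive sequences *)

Section Fekete.
Variables (R : realType) (a : nat -> R).
Hypothesis a_ge0 : forall n, 0 <= a n.
Hypothesis aD : forall m n, a (m + n)%N <= a m + a n.

Lemma subadditive_mul q m : a (q * m)%N <= q%:R * a m + a 0.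
Proof.
elim: q => [|q IH]; first by rewrite mul0n mul0r add0r.
rewrite mulSn (le_trans (aD _ _))// -natr1 mulrDl mul1r [_ * _ + _]addrC -addrA.
by rewrite lerD2l.
Qed.

(** The limit is the infimum of the quotients. Euclidean division of [n] by a nearly optimal [m.+1]
    bounds [a n] by a multiple of [a m.+1] plus a constant, and the constant vanishes after division
    by [n]. *)
Lemma subadditive_cvg : cvgn (fun n => n%:R^-1 * a n).
Proof.
(* Index 0 is left out: the inverse of 0 is 0, so it would put a spurious 0 in the set. *)
pose S := [set n.+1%:R^-1 * a n.+1 | n in [set: nat]].
have S0 : S !=set0 by exists (1%:R^-1 * a 1); exists 0.
have lbS : has_lbound S.
  by exists 0 => _ [n _ <-]; rewrite mulr_ge0// invr_ge0.
have Sinf : has_inf S by split.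
apply/cvg_ex; exists (inf S); apply/cvgrPdist_le => e e0.
have e20 : 0 < e / 2 by rewrite divr_gt0.
have [_ [m _ <-] hm] := inf_adherent e20 Sinf.
(* Bounds [a r] for every remainder [r], plus the extra [a 0] that [subadditive_mul] costs on the
   quotient part. *)
pose C := m.+1%:R * a 1 + a 0 + a 0.
have C0 : 0 <= C by rewrite !addr_ge0 ?mulr_ge0.
near=> n.
have n0 : (0 < n)%N by near: n; exists 1%N.
have lb : inf S <= n%:R^-1 * a n.
  by apply: ge_inf => //; exists n.-1 => //; rewrite prednK.
rewrite ler0_norm ?subr_le0// opprB lerBlDl.
have bn : a n <= (n %/ m.+1)%:R * a m.+1 + C.
  rewrite {1}(divn_eq n m.+1); set q := (n %/ m.+1)%N; set r := (n %% m.+1)%N.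
  have hq := subadditive_mul q m.+1.
  have hr : a r <= m.+1%:R * a 1 + a 0.
    rewrite -[X in a X]muln1 (le_trans (subadditive_mul _ _))// lerD2r.
    by rewrite ler_wpM2r// ler_nat ltnW// ltn_pmod.
  have := aD (q * m.+1) r; rewrite /C; lra.
have nR0 : 0 < n%:R :> R by rewrite ltr0n.
rewrite ler_pdivrMl// (le_trans bn)//.
have h1 : (n %/ m.+1)%:R * a m.+1 <= n%:R * (m.+1%:R^-1 * a m.+1).
  rewrite mulrA ler_wpM2r// ler_pdivlMr// -natrM ler_nat.
  exact: leq_divM.
have h2 : n%:R * (m.+1%:R^-1 * a m.+1) <= n%:R * (inf S + e / 2).
  by rewrite ler_pM2l// ltW.
have h3 : C <= n%:R * (e / 2).
  by rewrite -ler_pdivrMr//; near: n; exact: nbhs_infty_ger.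
by rewrite (le_trans (lerD (le_trans h1 h2) h3))// -mulrDr -addrA -splitr.
Unshelve. all: by end_near. Qed.

End Fekete.

(** * Minimal size of a subcover *)

Section CoverNumber.
Context (R : realType) (T : topologicalType).
Implicit Types (W U : set (set T)) (f : T -> T).

(** Indexed families may repeat members, so products and images of subcovers need no cardinality
    computation. *)
Definition has_subcover W k := exists s : 'I_k -> set T,
  (forall i, W (s i)) /\ forall p, exists i, s i p.

Lemma has_subcover_fin W (C : finType) (s : C -> set T) :
  (forall i, W (s i)) -> (forall p, exists i, s i p) -> has_subcover W #|C|.
Proof.
move=> sW sc; exists (s \o enum_val); split=> [i|p]; first exact: sW.
by have [i ip] := sc p; exists (enum_rank i); rewrite /= enum_rankK.
Qed.

(** Repetitions do not change the minimum: the range of a family of [j] sets is a subcover with at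
    most [j] members. The infimum is attained because it runs over natural numbers. *)
Lemma cover_numberP W k : has_subcover W k ->
  exists j, [/\ cover_number R W = j%:R%:E, has_subcover W j &
    forall i, has_subcover W i -> (j <= i)%N].
Proof.
move=> Wk.
have exW : exists k, `[< has_subcover W k >] by exists k; exact/asboolP.
have jP := ex_minnP exW; case: jP => j /asboolP Wj jmin.
have {}jmin i : has_subcover W i -> (j <= i)%N by move=> /asboolP /jmin.
exists j; split=> //; apply/eqP; rewrite eq_le; apply/andP; split; last first.
  apply: le_ereal_inf_tmp => _ [i [V [VW Vc]] Vi <-].
  move: Vi; rewrite card_eq_sym => /card_set_bijP[g [gV _ gsurj]].
  rewrite lee_fin ler_nat; apply: jmin.
  exists (fun u => g (val u)); split=> [u|p].
    by apply: VW; apply: gV => /=; exact: ltn_ord.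
  have [A VA Ap] : (\bigcup_(A in V) A) p by rewrite Vc.
  have [u ui gu] := gsurj _ VA.
  by exists (Ordinal ui); rewrite /= gu.
have [s [sW sc]] := Wj.
have /finite_setP[i ri] : finite_set (range s) by exact: finite_image.
have covr : covering (range s).
  by apply/seteqP; split=> // p _; have [u up] := sc p; exists (s u).
have rW : range s `<=` W by move=> _ [u _ <-].
have ij : (i <= j)%N.
  rewrite -card_le_II -(card_le_eql ri) (card_le_eqr card_II).
  exact: card_image_le.
apply: ge_ereal_inf; exists i%:R%:E; last by rewrite lee_fin ler_nat.
by exists i => //; exists (range s).
Qed.

End CoverNumber.

(** * Iterated covers and the entropy of one cover *)

Section Entropy.
Context (R : realType) (T : topologicalType).
Implicit Types (W U : set (set T)) (f : T -> T).

(** Replaces the iterated join by an itinerary, that is, a choice of a member of [U] at each time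
    before [n]. *)
Lemma cover_iterP f U n A : cover_iter f U n A <->
  exists s : nat -> set T, (forall i, (i < n)%N -> U (s i)) /\
    A = [set p | forall i, (i < n)%N -> s i (iter i f p)].
Proof.
rewrite /cover_iter.
(* Peeling off the first factor of the join delays the others by one step, so the induction carries
   a starting time [k]. *)
pose G k m := \big[@cover_join T/[set [set: T]]]_(i < m)
  cover_preimage (iter (k + i) f) U.
suff : forall m k A, G k m A <-> exists s : nat -> set T,
    (forall i, (i < m)%N -> U (s i)) /\
    A = [set p | forall i, (i < m)%N -> s i (iter (k + i) f p)].
  by move=> /(_ n 0 A).
elim=> [|m IH] k {}A.
  rewrite /G big_ord0; split=> [->|[s [_ ->]]]; last by apply/seteqP; split.
  by exists (fun=> setT); split=> //; apply/seteqP; split.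
rewrite /G big_ord_recl /= addn0.
under eq_bigr do rewrite /bump /= add1n addnS -addSn.
split.
  move=> [_ [B UB <-] [C /IH [s [sU ->]] <-]].
  exists (fun i => if i is j.+1 then s j else B); split=> [[|i]//|].
    exact: sU.
  apply/seteqP; split=> p /=.
    by move=> [Bp sp] [|i]; rewrite ?addn0// => im; rewrite addnS -addSn;
      apply: sp.
  move=> h; split; first by have := h 0 isT; rewrite addn0.
  by move=> i im; have := h i.+1 im; rewrite addnS -addSn.
move=> [s [sU ->]].
exists (iter k f @^-1` s 0); first by exists (s 0) => //; exact: sU.
exists [set p | forall i, (i < m)%N -> s i.+1 (iter (k.+1 + i) f p)].
  by apply/IH; exists (s \o S); split=> // i im; apply: sU.
apply/seteqP; split=> p /=.
  by move=> [Bp sp] [|i]; rewrite ?addn0// => im; rewrite addnS -addSn;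
      apply: sp.
move=> h; split; first by have := h 0 isT; rewrite addn0.
by move=> i im; have := h i.+1 im; rewrite addnS -addSn.
Qed.

Lemma has_subcover_iter0 f U : has_subcover (cover_iter f U 0) 1.
Proof.
exists (fun=> setT); split=> [_|p]; last by exists ord0.
by apply/cover_iterP; exists (fun=> setT); split=> //; apply/seteqP; split.
Qed.

(** Itineraries concatenate, the second one being read from time [m] on. This makes cover numbers
    submultiplicative. *)
Lemma cover_iterD f U m n A B :
  cover_iter f U m A -> cover_iter f U n B ->
  cover_iter f U (m + n) (A `&` iter m f @^-1` B).
Proof.
move=> /cover_iterP[s [sU ->]] /cover_iterP[t [tU ->]]; apply/cover_iterP.
exists (fun i => if (i < m)%N then s i else t (i - m)%N); split=> [i imn|].
  case: ifPn => [|im]; [exact: sU|apply: tU; lia].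
apply/seteqP; split=> p /=.
  move=> [sp tp] i imn; case: ifPn => [|im]; first exact: sp.
  have := tp (i - m)%N; rewrite -iterD subnK; last by rewrite leqNgt.
  by apply; lia.
move=> h; split=> i im.
  by have := h i; rewrite im; apply; lia.
have := h (m + i)%N; rewrite ltn_add2l => /(_ im).
by rewrite ltnNge leq_addr /= addKn -iterD addnC.
Qed.

Lemma has_subcover_iterD f U m n k l :
  has_subcover (cover_iter f U m) k -> has_subcover (cover_iter f U n) l ->
  has_subcover (cover_iter f U (m + n)) (k * l).
Proof.
move=> [s [sU sc]] [t [tU tc]].
rewrite -[k]card_ord -[l]card_ord -card_prod.
apply: (@has_subcover_fin _ _ _
  (fun ij : 'I_k * 'I_l => s ij.1 `&` iter m f @^-1` t ij.2)) => [ij|p].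
  exact: cover_iterD.
by have [i si] := sc p; have [j tj] := tc (iter m f p); exists (i, j).
Qed.

Lemma has_subcover_iter f U k n :
  has_subcover U k -> has_subcover (cover_iter f U n) (k ^ n).
Proof.
move=> [s [sU sc]]; elim: n => [|n IH]; first exact: has_subcover_iter0.
rewrite expnS -add1n; apply: has_subcover_iterD IH.
exists s; split=> // i; apply/cover_iterP; exists (fun=> s i); split=> //.
apply/seteqP; split=> p /= => [sp [|//]|]; first by [].
by move=> /(_ 0 isT).
Qed.

Lemma compact_has_subcover U : compact [set: T] -> open_cover U ->
  exists k, has_subcover U k.
Proof.
move=> cT [oU Uc].
pose sub (s : seq (set T)) := forall A, A \in s -> U A.
(* What holds eventually along [F] holds for all finite lists from [U] that extend some fixed one.
   Near-covering compactness then gives one list that serves every point. *)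
pose F : set_system (seq (set T)) :=
  filter_from sub (fun s => [set t | sub t /\ {subset s <= t}]).
have FF : Filter F.
  apply: filter_from_filter; first by exists [::].
  move=> s t Us Ut; exists (s ++ t).
    by move=> A; rewrite mem_cat => /orP[/Us|/Ut].
  move=> r [Ur str]; split; split=> // A Ah; apply: str.
    by rewrite mem_cat Ah.
  by rewrite mem_cat Ah orbT.
have [|s Us sP] := (iffLR (compact_near_coveringP _) cT) _ F
    (fun s p => exists A, A \in s /\ A p) FF.
  move=> p _; have [A UA Ap] : (\bigcup_(A in U) A) p by rewrite Uc.
  exists (A, [set t | sub t /\ {subset [:: A] <= t}]) => /=.
    split; first by apply: open_nbhs_nbhs; split=> //; exact: oU.
    by exists [:: A] => // B; rewrite inE => /eqP->.
  by move=> [q t] /= [Aq [_ At]]; exists A; split=> //; apply: At; rewrite inE.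
exists (size s), (fun i => nth setT s i); split=> [i|p].
  by apply: Us; exact: mem_nth.
have [A [As Ap]] := sP s (conj Us (fun _ => id)) p I.
move: As => /(nthP setT)[i ilt iA].
by exists (Ordinal ilt); rewrite /= iA.
Qed.

(** The real sequence to which Fekete's lemma applies; [fine] loses nothing when [U] has a finite
    subcover. *)
Definition log_number f U n : R :=
  ln (fine (cover_number R (cover_iter f U n))).

Section OfFinite.
Variables (p0 : T) (f : T -> T) (U : set (set T)) (k0 : nat).
Hypothesis Uk0 : has_subcover U k0.

Lemma log_numberP n : exists j, [/\ (0 < j)%N,
  cover_number R (cover_iter f U n) = j%:R%:E,
  log_number f U n = ln j%:R,
  has_subcover (cover_iter f U n) j &
  forall i, has_subcover (cover_iter f U n) i -> (j <= i)%N].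
Proof.
have [j [jE Hj jmin]] := cover_numberP R (has_subcover_iter f n Uk0).
exists j; split=> //; last by rewrite /log_number jE.
(* The point [p0] rules out an empty subcover, so the logarithm is taken at a positive number. *)
by case: j Hj {jE jmin} => [[s [_ /(_ p0)[[]]]]|].
Qed.

Lemma log_number_le n i :
  has_subcover (cover_iter f U n) i -> log_number f U n <= ln i%:R.
Proof.
have [j [j0 _ -> _ jmin]] := log_numberP n => /jmin ji.
by rewrite ler_ln ?posrE ?ltr0n ?ler_nat// (leq_trans j0).
Qed.

Lemma log_number_ge0 n : 0 <= log_number f U n.
Proof. by have [j [j0 _ -> _ _]] := log_numberP n; rewrite ln_ge0// ler1n. Qed.

Lemma log_numberD m n :
  log_number f U (m + n) <= log_number f U m + log_number f U n.
Proof.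
have [j [j0 _ -> Hj _]] := log_numberP m.
have [k [k0' _ -> Hk _]] := log_numberP n.
rewrite -lnM ?posrE ?ltr0n// -natrM.
by apply: log_number_le; exact: has_subcover_iterD.
Qed.

Lemma cover_entropy_lim :
  cover_entropy R f U = (limn (fun n => n%:R^-1 * log_number f U n))%:E.
Proof.
rewrite /cover_entropy -EFin_lim; last first.
  by apply: subadditive_cvg; [exact: log_number_ge0|exact: log_numberD].
congr (limn _); apply/funext => n /=.
have [j [j0 -> -> _ _]] := log_numberP n.
by rewrite lne_EFin ?ltr0n// EFinM.
Qed.

Lemma log_number_cvg :
  n%:R^-1 * log_number f U n @[n --> \oo] --> fine (cover_entropy R f U).
Proof.
rewrite cover_entropy_lim; apply: subadditive_cvg.
- exact: log_number_ge0.
- exact: log_numberD.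
Qed.

Lemma cover_entropy_fin_num : cover_entropy R f U \is a fin_num.
Proof. by rewrite cover_entropy_lim. Qed.

End OfFinite.
End Entropy.

(** * Entropy of a factor and of an extension with controlled fibres *)

Section Factor.
Context (R : realType) (X Y : topologicalType).
Variables (f : X -> X) (g : Y -> Y) (h : X -> Y).
Hypothesis cX : compact [set: X].
Hypothesis ch : continuous h.
Hypothesis hsurj : forall y, exists p, h p = y.
Hypothesis hf : forall p, h (f p) = g (h p).
Variable p0 : X.

Lemma factor_iter n p : h (iter n f p) = iter n g (h p).
Proof. by elim: n => //= n <-. Qed.

Lemma factor_compact : compact [set: Y].
Proof.
have -> : [set: Y] = h @` [set: X].
  by apply/seteqP; split=> // y _; have [p <-] := hsurj y; exists p.
by apply: continuous_compact => //; exact: continuous_subspaceT.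
Qed.

(** An open cover of [Y] is pulled back along [h]. Since [h] is onto, a subcover of the iterated
    pullback pushes down to one of the same size. *)
Lemma topological_entropy_factor :
  (topological_entropy R g <= topological_entropy R f)%E.
Proof.
apply: ge_ereal_sup => _ [V ocV <-].
have [oV Vc] := ocV.
have [l Vl] := compact_has_subcover factor_compact ocV.
pose U := [set h @^-1` B | B in V].
have ocU : open_cover U.
  split=> [_ [B /oV oB <-]|]; first by move/continuousP : ch; apply.
  apply/seteqP; split=> // p _.
  have [B VB Bp] : (\bigcup_(A in V) A) (h p) by rewrite Vc.
  by exists (h @^-1` B) => //; exists B.
have [k Uk] := compact_has_subcover cX ocU.
apply: le_ereal_sup_tmp; exists (cover_entropy R f U); first by exists U.
rewrite -[leLHS]fineK ?(cover_entropy_fin_num R (h p0) g Vl)//.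
rewrite -[leRHS]fineK ?(cover_entropy_fin_num R p0 f Uk)// lee_fin.
apply: (ler_cvg_to (log_number_cvg (h p0) Vl) (log_number_cvg p0 Uk)).
apply: nearW => n; rewrite ler_wpM2l ?invr_ge0//.
have [j [_ _ -> [s [sU sc]] _]] := log_numberP R p0 f Uk n.
apply: (log_number_le R (h p0) Vl).
have /choice[t tP] : forall i, exists B,
    cover_iter g V n B /\ s i `<=` h @^-1` B.
  move=> i; have /cover_iterP[r [rU ->]] := sU i.
  have /choice[w wP] : forall u, exists B, (u < n)%N -> V B /\ r u = h @^-1` B.
    move=> u; case: (boolP (u < n)%N) => [/rU [B VB <-]|_]; last by exists setT.
    by exists B.
  exists [set y | forall u, (u < n)%N -> w u (iter u g y)]; split.
    by apply/cover_iterP; exists w; split=> // u /wP[].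
  move=> p /= rp u un; have [_ ru] := wP _ un.
  by rewrite -factor_iter; have := rp _ un; rewrite ru.
exists t; split=> [i|y]; first by have [] := tP i.
have [p <-] := hsurj y; have [i sp] := sc p.
by exists i; have [_] := tP i; apply.
Qed.

(** Points of one fibre with the same colour in [C] share an itinerary for all time. The number of
    colours depends on [U] alone, neither on the fibre nor on the length of the itinerary. *)
Definition uniformly_stable_fibers := forall U, open_cover U ->
  exists (C : finType) (c : X -> C), forall p, exists A : nat -> set X,
    (forall n, U (A n)) /\
    forall q, h q = h p -> c q = c p -> forall n, A n (iter n f q).

Hypothesis hY : hausdorff_space Y.

(** The map [h] is closed: the complement of [O] is compact, so its image is compact, hence closed
    in the Hausdorff space [Y]. *)
Lemma tube y (O : set X) : open O -> h @^-1` [set y] `<=` O ->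
  exists W, [/\ open W, W y & h @^-1` W `<=` O].
Proof.
move=> oO yO; exists (~` (h @` (~` O))); split.
- apply: closed_openC; apply: compact_closed => //.
  apply: continuous_compact; first exact: continuous_subspaceT.
  by apply: subclosed_compact cX _ => //; exact: open_closedC.
- by move=> [p Op hp]; apply: Op; exact: yO.
- by move=> p /= hp; apply: contrapT => Op; apply: hp; exists p.
Qed.

Hypothesis cf : continuous f.

Lemma cover_iter_open U n A : (forall B, U B -> open B) ->
  cover_iter f U n A -> open A.
Proof.
move=> oU /cover_iterP[s [sU ->]].
have citer i : continuous (iter i f).
  elim: i => [|i IH] p; first exact: cvg_id.
  by apply: continuous_comp; [exact: IH|exact: cf].
elim: n sU => [|n IH] sU.
  have -> : [set p | forall i, (i < 0)%N -> s i (iter i f p)] = setT.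
    by apply/seteqP; split.
  exact: openT.
have -> : [set p | forall i, (i < n.+1)%N -> s i (iter i f p)] =
    [set p | forall i, (i < n)%N -> s i (iter i f p)] `&` iter n f @^-1` s n.
  apply/seteqP; split=> p /=.
    by move=> sp; split=> [i /ltnW|]; exact: sp.
  by move=> [sp spn] i; rewrite ltnS leq_eqVlt => /orP[/eqP->|/sp].
apply: openI; first by apply: IH => i /ltnW; exact: sU.
by move/continuousP : (citer n); apply; apply: oU; exact: sU.
Qed.

(* Reading a member of this cover at each of the times 0, m, 2m, ... along an
   orbit of g leaves only N choices of an f-itinerary per block of length m. *)
Let base_cover (U : set (set X)) N m : set (set Y) :=
  [set W | open W /\ exists s : 'I_N -> set X,
    (forall i, cover_iter f U m (s i)) /\
    forall p, W (h p) -> exists i, s i p].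

(** Induction on the number of blocks: the set chosen at time 0 gives [N] itineraries for the first
    block, and the induction hypothesis at [iter m f p] handles the rest. *)
Lemma base_cover_iter U N m n B : (0 < m)%N ->
  cover_iter g (base_cover U N m) (n * m) B ->
  exists s : 'I_(N ^ n) -> set X,
    (forall i, cover_iter f U (n * m) (s i)) /\
    forall p, B (h p) -> exists i, s i p.
Proof.
move=> m0; elim: n B => [|n IH] B.
  move=> _; have [s [sU sc]] := has_subcover_iter0 f U.
  by exists s; split=> // p _; exact: sc.
move=> /cover_iterP[s [sU ->]].
have [_ [t [tU tc]]] : base_cover U N m (s 0) by apply: sU; lia.
have [|r [rU rc]] := IH [set y | forall i,
     (i < n * m)%N -> s (m + i)%N (iter i g y)].
  apply/cover_iterP; exists (fun i => s (m + i)%N); split=> // i im.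
  by apply: sU; lia.
have [w [wU wc]] : exists w : 'I_N * 'I_(N ^ n) -> set X,
    (forall i, cover_iter f U (n.+1 * m) (w i)) /\
    forall p, (forall i, (i < n.+1 * m)%N -> s i (iter i g (h p))) ->
      exists i, w i p.
  exists (fun ij => t ij.1 `&` iter m f @^-1` r ij.2); split=> [ij|p sp].
    by rewrite mulSn; exact: cover_iterD.
  have [i ti] := tc p (sp 0 ltac:(lia)).
  have [|j rj] := rc (iter m f p).
    move=> j jm; rewrite factor_iter -iterD addnC; apply: sp; lia.
  by exists (i, j).
have cE : #|{: 'I_N * 'I_(N ^ n)}| = (N ^ n.+1)%N.
  by rewrite card_prod !card_ord expnS.
exists (w \o enum_val \o cast_ord (esym cE)); split=> [i|p /wc[i wi]].
  exact: wU.
by exists (cast_ord cE (enum_rank i)); rewrite /= cast_ordK enum_rankK.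
Qed.

(** Over a point [y], each colour selects one itinerary. The union of the corresponding open sets
    contains the fibre, hence the preimage of a neighbourhood of [y] by [tube]. *)
Lemma base_cover_open_cover U (C : finType) (c : X -> C) m :
  (forall B, U B -> open B) ->
  (forall p, exists A : nat -> set X, (forall n, U (A n)) /\
    forall q, h q = h p -> c q = c p -> forall n, A n (iter n f q)) ->
  open_cover (base_cover U #|C| m).
Proof.
move=> oU UC; split=> [W []//|]; apply/seteqP; split=> // y _.
have [py hpy] := hsurj y.
have /choice[t tP] : forall i : C, exists A, cover_iter f U m A /\
    forall q, h q = y -> c q = i -> A q.
  move=> i; have [[p [hp cp]]|np] := pselect (exists p, h p = y /\ c p = i).
    have [A [UA AP]] := UC p.
    exists [set q | forall n, (n < m)%N -> A n (iter n f q)]; split.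
      by apply/cover_iterP; exists A.
    by move=> q hq cq n _; apply: AP; [rewrite hq|rewrite cq].
  (* A colour absent from the fibre receives any itinerary, here that of the preimage [py]. *)
  have [A [UA AP]] := UC py.
  exists [set q | forall n, (n < m)%N -> A n (iter n f q)]; split.
    by apply/cover_iterP; exists A.
  by move=> q hq cq; case: np; exists q.
have oO : open (\bigcup_i t i).
  apply: bigcup_open => i _; apply: (@cover_iter_open U m) => //.
  by have [] := tP i.
have [|W [oW Wy WO]] := @tube y _ oO.
  by move=> q /= hq; exists (c q) => //; have [_] := tP (c q); apply.
exists W => //; split=> //; exists (t \o enum_val); split=> [i|p /WO[i _ ti]].
  by have [] := tP (enum_val i).
by exists (enum_rank i); rewrite /= enum_rankK.
Qed.

Lemma topological_entropy_extension : uniformly_stable_fibers ->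
  (topological_entropy R f <= topological_entropy R g)%E.
Proof.
move=> usf; apply: ge_ereal_sup => _ [U ocU <-].
have [oU Uc] := ocU.
have [k Uk] := compact_has_subcover cX ocU.
have [C [c UC]] := usf _ ocU.
rewrite -[leLHS]fineK ?(cover_entropy_fin_num R p0 f Uk)//.
set N := #|C|.
have N0 : (0 < N)%N by apply/card_gt0P; exists (c p0).
have key m : (0 < m)%N ->
    ((fine (cover_entropy R f U) - m%:R^-1 * ln N%:R)%:E
      <= topological_entropy R g)%E.
  move=> m0.
  have ocV := @base_cover_open_cover U C c m oU UC.
  have [l Vl] := compact_has_subcover factor_compact ocV.
  apply: le_ereal_sup_tmp; exists (cover_entropy R g (base_cover U N m)).
    by exists (base_cover U N m).
  rewrite -[leRHS]fineK ?(cover_entropy_fin_num R (h p0) g Vl)//.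
  rewrite lee_fin lerBlDl.
  (* Limits are compared along multiples of [m], where time splits into whole blocks. *)
  have cvgm (u : nat -> R) (l' : R) :
      u n @[n --> \oo] --> l' -> u (n * m)%N @[n --> \oo] --> l'.
    move=> ul; apply: (cvg_comp _ _ _ ul) => A [M _ MA].
    exists M => // n /= Mn; apply: MA => /=.
    by rewrite (leq_trans Mn)// leq_pmulr.
  have cf' := cvgm _ _ (log_number_cvg p0 (f := f) Uk).
  have cg := cvgm _ _ (log_number_cvg (h p0) (f := g) Vl).
  have {}cg : m%:R^-1 * ln N%:R +
        (n * m)%:R^-1 * log_number R g (base_cover U N m) (n * m)
      @[n --> \oo] -->
      m%:R^-1 * ln N%:R + fine (cover_entropy R g (base_cover U N m)).
    by apply: cvgD => //; exact: cvg_cst.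
  apply: (ler_cvg_to cf' cg); near=> n.
  have n0 : (0 < n)%N by near: n; exists 1%N.
  have nm0 : 0 < (n * m)%:R :> R by rewrite ltr0n muln_gt0 n0.
  rewrite /=.
  have [j [j0 _ -> [s [sV sc]] _]] := log_numberP R (h p0) g Vl (n * m).
  (* Each of the [j] sets of a minimal subcover downstairs leaves [N ^ n] itineraries upstairs. *)
  suff : log_number R f U (n * m) <= n%:R * ln N%:R + ln j%:R.
    rewrite -(ler_pM2l (_ : 0 < (n * m)%:R^-1)) ?invr_gt0//.
    move=> /le_trans; apply; rewrite mulrDr lerD2r.
    by rewrite natrM invfM mulrA [_ * n%:R]mulrAC mulVf ?mul1r// gt_eqF ?ltr0n.
  rewrite [n%:R * _]mulr_natl -lnXn ?ltr0n// -natrX.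
  rewrite -lnM ?posrE ?ltr0n ?expn_gt0 ?N0// -natrM.
  apply: (log_number_le R p0 Uk).
  have /choice[t tP] : forall i : 'I_j, exists r : 'I_(N ^ n) -> set X,
      (forall u, cover_iter f U (n * m) (r u)) /\
      forall p, s i (h p) -> exists u, r u p.
    by move=> i; exact: base_cover_iter.
  rewrite -[(N ^ n)%N]card_ord -[j]card_ord -card_prod.
  apply: (@has_subcover_fin _ _ _
    (fun ui : 'I_(N ^ n) * 'I_j => t ui.2 ui.1)) => [ui|p].
    by have [] := tP ui.2.
  have [i si] := sc (h p); have [_ /(_ p si)[u tu]] := tP i.
  by exists (u, i).
(* The block length is free: take it beyond [ln N%:R / e], so that the error term is at most [e]. *)
apply/lee_addgt0Pr => e e0.
have [m mP] : exists m : nat, ln N%:R / e < m%:R.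
  by exists (Num.truncn (ln N%:R / e)).+1; exact: truncnS_gt.
have := key m.+1 isT.
rewrite EFinB leeBlDr// => /le_trans; apply; rewrite leeD2l// lee_fin.
rewrite ler_pdivrMl// -ler_pdivrMr// (le_trans (ltW mP))// ler_nat//.
Unshelve. all: by end_near. Qed.

End Factor.

(** * Closeness, separation and compactness in R/Z *)

Section Torus.
Local Open Scope quotient_scope.
Context (R : realType).
Implicit Types (a b e : R) (s t : torus R).

Definition proj_torus a : torus R :=
  \pi_(quotient_topology (Quotient.quot (int_subgroup R))) a.

Lemma proj_torus_surj t : exists a, proj_torus a = t.
Proof. by exists (repr t); exact: reprK. Qed.

Lemma proj_torusD a b : proj_torus (a + b) = proj_torus a + proj_torus b.
Proof. exact: Quotient.pi_add. Qed.

Lemma proj_torusN a : proj_torus (- a) = - proj_torus a.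
Proof. exact: Quotient.pi_opp. Qed.

Lemma proj_torusB a b : proj_torus (a - b) = proj_torus a - proj_torus b.
Proof. by rewrite proj_torusD proj_torusN. Qed.

Lemma proj_torus_eq a b : proj_torus a = proj_torus b <-> a - b \is a Num.int.
Proof.
rewrite -int_subgroupE Quotient.idealrBE.
by split=> [h|/eqP//]; apply/eqP.
Qed.

Lemma proj_torus_int a : a \is a Num.int -> proj_torus a = 0.
Proof.
move=> ia; have -> : (0 : torus R) = proj_torus 0.
  by rewrite -[0 in RHS](subrr 0) proj_torusB subrr.
by apply/proj_torus_eq; rewrite subr0.
Qed.

Lemma proj_torus_continuous : continuous proj_torus.
Proof. exact: pi_continuous. Qed.

(** The quotient distance is less than [e], expressed by a small representative [a] of [t - s].
    Keeping [a] explicit allows the same displacement to be reused at another pair of points. *)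
Definition near_torus e s t := exists a, `|a| < e /\ t = s + proj_torus a.

Lemma near_torus_sym e s t : near_torus e s t -> near_torus e t s.
Proof.
by move=> [a [ae ->]]; exists (- a); rewrite normrN proj_torusN addrK.
Qed.

Lemma near_torusD e e' s s' t t' : near_torus e s t -> near_torus e' s' t' ->
  near_torus (e + e') (s + s') (t + t').
Proof.
move=> [a [ae ->]] [b [be ->]]; exists (a + b).
by rewrite proj_torusD addrACA (le_lt_trans (ler_normD _ _)) ?ltrD.
Qed.

Lemma near_torusN e s t : near_torus e s t -> near_torus e (- s) (- t).
Proof.
by move=> [a [ae ->]]; exists (- a); rewrite normrN proj_torusN opprD.
Qed.

Lemma near_torusB e e' s s' t t' : near_torus e s t -> near_torus e' s' t' ->
  near_torus (e + e') (s - s') (t - t').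
Proof. by move=> st /near_torusN; exact: near_torusD. Qed.

Lemma near_torus_trans e e' s t u :
  near_torus e s t -> near_torus e' t u -> near_torus (e + e') s u.
Proof.
move=> [a [ae ->]] [b [be ->]]; exists (a + b).
by rewrite proj_torusD addrA (le_lt_trans (ler_normD _ _)) ?ltrD.
Qed.

Lemma near_torusW e e' s t : e <= e' -> near_torus e s t -> near_torus e' s t.
Proof. by move=> ee [a [ae ->]]; exists a; rewrite (lt_le_trans ae). Qed.

Lemma near_torus_proj e a b :
  `|b - a| < e -> near_torus e (proj_torus a) (proj_torus b).
Proof.
by move=> abe; exists (b - a); rewrite -proj_torusD [a + _]addrC subrK.
Qed.

(** A non-integer real has positive distance to the integers, so a nonzero class has no arbitrarily
    small representatives. *)
Lemma near_torus_eq s t : (forall e, 0 < e -> near_torus e s t) -> t = s.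
Proof.
have [b bE] := proj_torus_surj (t - s).
move=> st; apply/eqP; rewrite -subr_eq0 -bE; apply/eqP/proj_torus_int.
have [bi|bfl] := eqVneq (Num.floor b)%:~R b; first by rewrite -bi intr_int.
have fb : (Num.floor b)%:~R < b by rewrite lt_neqAle bfl floor_le_tmp.
have bf := floorD1_gt b.
(* This minimum is the distance from [b] to the nearest integer. *)
have e0 : 0 < Num.min (b - (Num.floor b)%:~R) ((Num.floor b + 1)%:~R - b).
  by rewrite lt_min !subr_gt0 fb bf.
have [a [ae tE]] := st _ e0.
have /proj_torus_eq/intrP[k kE] : proj_torus b = proj_torus a.
  by rewrite bE tE addrAC subrr add0r.
move: ae; rewrite lt_min => /andP[]; rewrite !ltr_norml.
move=> /andP[h1 h2] /andP[h3 h4].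
have : (k < Num.floor b + 1)%R && (Num.floor b < k)%R.
  rewrite -!(ltr_int R) -kE; apply/andP; split; lra.
lia.
Qed.

Lemma nbhs_near_torus e s : 0 < e -> nbhs s [set t | near_torus e s t].
Proof.
move=> e0; rewrite nbhsE /=; exists [set t | near_torus e s t] => //.
split; last first.
  by exists 0; rewrite normr0 proj_torus_int ?addr0// int_num0.
(* Openness in the quotient topology is openness of the preimage in the reals. *)
change (open (proj_torus @^-1` [set t | near_torus e s t])).
rewrite openE => b [a [ae bE]]; rewrite /interior.
have d0 : 0 < e - `|a| by rewrite subr_gt0.
apply/nbhs_ballP; exists (e - `|a|) => // c /=.
rewrite -ball_normE /= => bc; exists (a + (c - b)); split.
  by rewrite (le_lt_trans (ler_normD _ _))// -ltrBrDl distrC.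
by rewrite proj_torusD addrA -bE -proj_torusD addrC subrK.
Qed.

Lemma nbhs_torusP s A : nbhs s A ->
  exists2 e, 0 < e & forall t, near_torus e s t -> A t.
Proof.
have [b <-] := proj_torus_surj s.
move=> /proj_torus_continuous/nbhs_ballP[e /= e0 eA].
exists e => // _ [a [ae ->]].
rewrite -proj_torusD; apply: eA.
by rewrite -ball_normE /= opprD addNKr normrN.
Qed.

Lemma torus_hausdorff : hausdorff_space (torus R).
Proof.
move=> s t st; apply/esym/near_torus_eq => e e0.
have e20 : 0 < e / 2 by rewrite divr_gt0.
have [u [su tu]] := st _ _ (nbhs_near_torus s e20) (nbhs_near_torus t e20).
by rewrite (splitr e); apply: near_torus_trans su _; exact: near_torus_sym.
Qed.

Definition frac b := b - (Num.floor b)%:~R.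

Lemma proj_torus_frac b : proj_torus (frac b) = proj_torus b.
Proof.
by apply/proj_torus_eq; rewrite /frac addrAC subrr add0r rpredN intr_int.
Qed.

Lemma frac_itv b : 0 <= frac b < 1.
Proof.
have := floor_le_tmp b; have := floorD1_gt b; rewrite /frac intrD; lra.
Qed.

Lemma torus_compact : compact [set: torus R].
Proof.
have -> : [set: torus R] = proj_torus @` `[0, 1].
  apply/seteqP; split=> // t _; have [b <-] := proj_torus_surj t.
  exists (frac b); last exact: proj_torus_frac.
  by rewrite /= in_itv /=; have /andP[-> /ltW ->] := frac_itv b.
apply: continuous_compact; last exact: segment_compact.
apply: continuous_subspaceT; exact: proj_torus_continuous.
Qed.

(** Cut [0, 1) into equal intervals shorter than [e]; the colour of a point is the interval
    containing its fractional representative. *)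
Lemma torus_finite_net e : 0 < e -> exists (N : nat) (c : torus R -> 'I_N),
  forall s t, c s = c t -> near_torus e s t.
Proof.
move=> e0; pose N := Num.truncn e^-1.
have Ne : e^-1 < N.+1%:R by exact: truncnS_gt.
have cN s : (Num.truncn (N.+1%:R * frac (repr s)) < N.+1)%N.
  have /andP[f0 f1] := frac_itv (repr s).
  by rewrite truncn_lt_nat ?mulr_ge0// gtr_pMr ?ltr0n.
exists N.+1, (fun s => Ordinal (cN s)) => s t /(congr1 val) /= cst.
have pE u : u = proj_torus (frac (repr u)).
  by rewrite proj_torus_frac [RHS]reprK.
rewrite (pE s) (pE t); apply: near_torus_proj.
move: cst (frac_itv (repr s)) (frac_itv (repr t)).
move: (frac (repr s)) (frac (repr t)) => x y xy /andP[x0 _] /andP[y0 _].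
have N0 : 0 < N.+1%:R :> R by rewrite ltr0n.
have Nx : 0 <= N.+1%:R * x by rewrite mulr_ge0.
have Ny : 0 <= N.+1%:R * y by rewrite mulr_ge0.
have := truncn_itv Nx; have := truncn_itv Ny; rewrite xy.
move=> /andP[h1 h2] /andP[h3 h4].
have Ne1 : 1 < N.+1%:R * e by rewrite -ltr_pdivrMr// mul1r.
rewrite -(ltr_pM2l N0) -[X in X * `|_|]gtr0_norm// -normrM ltr_norml mulrBr.
move: h2 h4; rewrite -[(Num.truncn _).+1%:R]natr1; lra.
Qed.

End Torus.

(** * Cylinder neighbourhoods in sequence spaces *)

Section Cylinder.

Lemma nbhs_ptws_cylinder (K : topologicalType) (z : {ptws nat -> K})
    (P : nat -> set K) n :
  (forall k, nbhs (z k) (P k)) ->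
  nbhs z [set q : {ptws nat -> K} | forall k, (k < n)%N -> P k (q k)].
Proof.
move=> zP; elim: n => [|n IH]; first by apply: filterS filterT => q _ [].
have Pn : nbhs z [set q : {ptws nat -> K} | P n (q n)].
  exact: (@proj_continuous nat (fun=> K) n z _ (zP n)).
apply: filterS (filterI IH Pn) => q [/= qP qn] k.
by rewrite ltnS leq_eqVlt => /orP[/eqP->|/qP].
Qed.

Context (R : realType).

(** The cylinders around [z] generate a filter. As the product topology is a supremum of initial
    topologies, its convergence to [z] is checked one coordinate at a time. *)
Lemma nbhs_ptws_near (V : set (torus R)) (z : {ptws nat -> V}) A : nbhs z A ->
  exists e n, 0 < e /\ forall q : {ptws nat -> V},
    (forall k, (k < n)%N -> near_torus e (val (z k)) (val (q k))) -> A q.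
Proof.
pose F : set_system {ptws nat -> V} :=
  filter_from [set en : R * nat | 0 < en.1]
    (fun en => [set q | forall k, (k < en.2)%N ->
      near_torus en.1 (val (z k)) (val (q k))]).
have FF : Filter F.
  apply: filter_from_filter; first by exists (1, 0%N) => /=.
  move=> [e n] [e' n'] /= e0 e0'.
  exists (Num.min e e', maxn n n') => /=; first by rewrite lt_min e0.
  move=> q /= qz; split=> k kn.
    by apply: near_torusW (qz k _); rewrite ?ge_min ?lexx// leq_max kn.
  by apply: near_torusW (qz k _); rewrite ?ge_min ?lexx ?orbT// leq_max kn orbT.
suff Fz : F --> z.
  by move=> /Fz[[e n] /= e0 enA]; exists e, n.
apply/cvg_sup => k B /= [_ [[C oC <-] Cz] CB].
case: oC => D oD DC.
have [e e0 eD] : exists2 e, 0 < e & forall t, near_torus e (val (z k)) t -> D t.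
  by apply: nbhs_torusP; apply: open_nbhs_nbhs; split=> //;
      move: Cz; rewrite -DC.
exists (e, k.+1) => //= q qz; apply: CB => /=; rewrite -DC /=.
by apply: eD; apply: qz.
Qed.

End Cylinder.

(** * The orbit closure as a space of sequences in R/Z *)

Section Orbit.
Context (R : realType) (x : nat -> torus R).
Local Notation X := (@orbit_closure (torus R) x : Type).
Implicit Types (p q : X).

Definition coord p k : torus R := val (val p k).

Lemma coord_shift p k : coord (orbit_shift p) k = coord p k.+1.
Proof. by []. Qed.

Lemma coord_iter_shift p n k :
  coord (iter n (@orbit_shift _ x) p) k = coord p (n + k).
Proof. by elim: n k => //= n IH k; rewrite coord_shift IH addnS. Qed.

Lemma eq_coord p q : (forall k, coord p k = coord q k) -> p = q.
Proof. by move=> pq; apply/val_inj/funext => k; exact/val_inj/pq. Qed.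

Lemma coord_continuous k : continuous (coord ^~ k).
Proof.
move=> p A Ak.
have valc := @initial_continuous X _
  (fun q : X => val q : {ptws nat -> value_closure x}) p.
apply: (valc [set z | A (val (z k))]).
apply: (@proj_continuous nat (fun=> value_closure x) k (val p)
  [set v | A (val v)]).
exact: (@initial_continuous (value_closure x) _ set_val (val p k)).
Qed.

Lemma nbhs_cylinder p (P : nat -> set (torus R)) n :
  (forall k, nbhs (coord p k) (P k)) ->
  nbhs p [set q | forall k, (k < n)%N -> P k (coord q k)].
Proof.
move=> pP; elim: n => [|n IH]; first by apply: filterS filterT => q _ [].
apply: filterS (filterI IH (coord_continuous (pP n))) => q [/= qP qn] k.
by rewrite ltnS leq_eqVlt => /orP[/eqP->|/qP].
Qed.

Lemma nbhs_near p e n : 0 < e ->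
  nbhs p [set q | forall k, (k < n)%N -> near_torus e (coord p k) (coord q k)].
Proof.
move=> e0; apply: (@nbhs_cylinder p (fun k => near_torus e (coord p k))) => k.
exact: nbhs_near_torus.
Qed.

Lemma nbhs_nearP p A : nbhs p A -> exists e n, 0 < e /\
  forall q,
    (forall k, (k < n)%N -> near_torus e (coord p k) (coord q k)) -> A q.
Proof.
move=> [_ [[B oB <-] Bp] BA].
have [|e [n [e0 enB]]] := @nbhs_ptws_near _ _ (val p) B.
  by apply: open_nbhs_nbhs.
by exists e, n; split=> // q pq; apply: BA; exact: enB.
Qed.

(** With [lim_coord], this identifies the points of the orbit closure with the limits of tails of
    [x], so later arguments can ignore the nested subtypes. *)
Lemma coord_lim p e n : 0 < e ->
  exists m, forall k, (k < n)%N -> near_torus e (coord p k) (x (m + k)).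
Proof.
move=> e0; have clp : @orbit_closure _ x (val p) by exact: set_mem (valP p).
have [|_ [[m _ <-] mp]] := clp [set q | forall k, (k < n)%N ->
    near_torus e (coord p k) (val (q k))].
  apply: (@nbhs_ptws_cylinder _ (val p)
    (fun k => [set v | near_torus e (coord p k) (val v)])) => k.
  apply: (@initial_continuous (value_closure x) _ set_val (val p k)).
  exact: nbhs_near_torus.
by exists m => k /mp.
Qed.

Lemma lim_coord (z : nat -> torus R) :
  (forall e n, 0 < e -> exists m, forall k, (k < n)%N ->
    near_torus e (z k) (x (m + k))) ->
  exists p, forall k, coord p k = z k.
Proof.
move=> zx.
have zc k : z k \in value_closure x.
  apply/mem_set => A /nbhs_torusP[e e0 eA].
  have [m mz] := zx e k.+1 e0; exists (x (m + k)%N); split; first exact: imageT.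
  by apply: eA; apply: mz.
pose w : {ptws nat -> value_closure x} := fun k => SigSub (zc k).
have wc : w \in @orbit_closure _ x.
  apply/mem_set => A /nbhs_ptws_near[e [n [e0 enA]]].
  have [m mz] := zx e n e0; exists (tail_seq x m); split; first exact: imageT.
  exact: enA.
by exists (SigSub wc).
Qed.

Lemma tail_point m : exists p, forall k, coord p k = x (m + k).
Proof.
apply: lim_coord => e n e0; exists m => k _.
by exists 0; rewrite normr0 proj_torus_int ?addr0// int_num0.
Qed.

(** Tychonoff's theorem gives a cluster point in the full product of tori. It is again a limit of
    tails of [x], hence comes from the orbit closure. *)
Lemma orbit_closure_compact : compact [set: X].
Proof.
move=> F FF _.
pose co p : {ptws nat -> torus R} := coord p.
have cT : compact [set: {ptws nat -> torus R}].
  have := @tychonoff nat (fun=> torus R) (fun=> setT) (fun=> @torus_compact R).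
  by congr compact; apply/seteqP; split.
have [|z [_ zcl]] := cT (co @ F) _; first exact: filterT.
have cyl_nbhs e n : 0 < e -> nbhs z [set q : {ptws nat -> torus R} |
    forall k, (k < n)%N -> near_torus e (z k) (q k)].
  move=> e0.
  apply: (@nbhs_ptws_cylinder _ z (fun k => near_torus e (z k))) => k.
  exact: nbhs_near_torus.
have [w wz] : exists w, forall k, coord w k = z k.
  apply: lim_coord => e n e0.
  have e20 : 0 < e / 2 by rewrite divr_gt0.
  have Fr : F (co @^-1` range co) by apply: filterS filterT => p _; exists p.
  have [_ [[p _ <-] pz]] := zcl _ _ Fr (cyl_nbhs (e / 2) n e20).
  have [m pm] := coord_lim p n e20; exists m => k kn.
  by rewrite (splitr e); exact: near_torus_trans (pz k kn) (pm k kn).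
exists w; split=> // A B FA /nbhs_nearP[e [n [e0 enB]]].
have FcA : F (co @^-1` (co @` A)) by apply: filterS FA => p Ap; exists p.
have [_ [[p Ap <-] pz]] := zcl _ _ FcA (cyl_nbhs e n e0).
by exists p; split=> //; apply: enB => k kn; rewrite wz; exact: pz.
Qed.

Lemma orbit_closure_hausdorff : hausdorff_space X.
Proof.
move=> p q pq; apply: eq_coord => k; apply: torus_hausdorff => A B Ap Bq.
have [r [Ar Br]] := pq _ _ (coord_continuous Ap) (coord_continuous Bq).
by exists (coord r k).
Qed.

Lemma orbit_shift_continuous : continuous (@orbit_shift _ x).
Proof.
move=> p A /nbhs_nearP[e [n [e0 enA]]].
apply: filterS (nbhs_near p n.+1 e0) => q pq; apply: enA => k kn.
exact: pq.
Qed.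

(** Each point has a cylinder inside a member of [U]. Half of its radius absorbs the move to a
    nearby point, and compactness makes the other half uniform as [e] tends to 0. *)
Lemma lebesgue_number U : open_cover U -> exists2 e, 0 < e &
  forall p, exists A, U A /\
    forall q, (forall k, near_torus e (coord p k) (coord q k)) -> A q.
Proof.
move=> [oU Uc].
pose P e p := exists A, U A /\
  forall q, (forall k, near_torus e (coord p k) (coord q k)) -> A q.
have nearP : \forall e \near 0^'+, [set: X] `<=` P e.
  apply: (iffLR (compact_near_coveringP _) orbit_closure_compact).
  move=> p _; have [A UA Ap] : (\bigcup_(A in U) A) p by rewrite Uc.
  have /nbhs_nearP[e [n [e0 enA]]] : nbhs p A.
    by apply: open_nbhs_nbhs; split=> //; exact: oU.
  have e20 : 0 < e / 2 by rewrite divr_gt0.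
  exists ([set q | forall k, (k < n)%N ->
        near_torus (e / 2) (coord p k) (coord q k)],
      [set e' | e' < e / 2]) => /=.
    by split; [exact: nbhs_near|exact: nbhs_right_lt].
  move=> [q e'] /= [qp e'e]; exists A; split=> // r qr; apply: enA => k kn.
  rewrite (splitr e); apply: near_torus_trans (qp k kn) _.
  exact: near_torusW (ltW e'e) (qr k).
near ((0 : R)^'+) => e.
exists e => // p.
suff /(_ p I) : [set: X] `<=` P e by [].
by near: e.
Unshelve. all: by end_near. Qed.

End Orbit.

(** * The difference map and its fibres *)

Section Difference.
Context (R : realType) (x : nat -> torus R) (d : nat).
Hypothesis d_gt0 : (0 < d)%N.

Let y n := x (n + d)%N - x n.
Local Notation X := (@orbit_closure (torus R) x : Type).
Local Notation Y := (@orbit_closure (torus R) y : Type).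

Lemma difference_map_subproof (p : X) :
  exists v : Y, forall k, coord v k = coord p (k + d) - coord p k.
Proof.
apply: lim_coord => e n e0.
have e20 : 0 < e / 2 by rewrite divr_gt0.
have [m pm] := coord_lim p (n + d) e20; exists m => k kn.
rewrite (splitr e) /y -addnA; apply: near_torusB; apply: pm; lia.
Qed.

Definition difference_map p : Y := sval (cid (difference_map_subproof p)).

Lemma coord_difference_map p k :
  coord (difference_map p) k = coord p (k + d) - coord p k.
Proof. by rewrite /difference_map; case: cid. Qed.

Lemma difference_map_shift p :
  difference_map (orbit_shift p) = orbit_shift (difference_map p).
Proof.
apply: eq_coord => k.
by rewrite coord_difference_map !coord_shift coord_difference_map.
Qed.

Lemma difference_map_continuous : continuous difference_map.
Proof.
move=> p A /nbhs_nearP[e [n [e0 enA]]].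
have e20 : 0 < e / 2 by rewrite divr_gt0.
apply: filterS (nbhs_near p (n + d) e20) => q pq; apply: enA => k kn.
rewrite !coord_difference_map (splitr e); apply: near_torusB; apply: pq; lia.
Qed.

(** If tails of [y] converge to [v], the tails of [x] at the same positions have a cluster point by
    compactness, and its difference sequence is [v]. *)
Lemma difference_map_surj v : exists p, difference_map p = v.
Proof.
have /choice[m mP] n : exists m, forall k, (k < n)%N ->
    near_torus n.+1%:R^-1 (coord v k) (y (m + k)).
  by apply: coord_lim; rewrite invr_gt0.
have /choice[t tP] := tail_point x.
pose u := t \o m.
have [w [_ wcl]] := @orbit_closure_compact _ x (u @ \oo) _ filterT.
exists w; apply: eq_coord => k; rewrite coord_difference_map.
apply: near_torus_eq => e e0.
have e30 : 0 < e / 3 by rewrite divr_gt0.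
have Fv : \forall n \near \oo, near_torus (e / 3) (coord v k)
    (coord (u n) (k + d) - coord (u n) k).
  near=> n; rewrite /u /= !tP addnA.
  apply: near_torusW (mP n k _); last by near: n; exists k.+1.
  rewrite invf_ple ?posrE//; apply/ltW; rewrite (@lt_trans _ _ n%:R) ?ltr_nat//.
  by near: n; exact: nbhs_infty_gtr.
have [q [vq wq]] := wcl
  [set q | near_torus (e / 3) (coord v k)
    (coord q (k + d) - coord q k)] _
  Fv (nbhs_near w (k + d).+1 e30).
(* One third compares [v] with the differences of [q]; the other two compare [q] with [w] at [k + d]
   and at [k]. *)
have -> : e = e / 3 + (e / 3 + e / 3) by lra.
apply: near_torus_trans vq _; apply: near_torusB; apply/near_torus_sym/wq; lia.
Unshelve. all: by end_near. Qed.

(** Coordinate [k] is coordinate [k - d] plus a term common to the whole fibre. The displacement at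
    [k - d] thus recurs unchanged at [k], and no error accumulates. *)
Lemma difference_map_near e p q : difference_map q = difference_map p ->
  (forall k, (k < d)%N -> near_torus e (coord p k) (coord q k)) ->
  forall k, near_torus e (coord p k) (coord q k).
Proof.
move=> qp pqd k; have [n] := ubnP k; elim: n k => // n IH k kn.
have [/pqd//|dk] := ltnP k d.
have kE z : coord z k = coord (difference_map z) (k - d) + coord z (k - d).
  by rewrite coord_difference_map subnK// subrK.
have [|a [ae aE]] := IH (k - d)%N; first by lia.
by exists a; rewrite !kE qp aE addrA.
Qed.

(** The colour records the net cells of the first [d] coordinates. Equal colours in a fibre force
    closeness at all coordinates, so the Lebesgue number applies after every shift. *)
Lemma difference_map_fibers :
  uniformly_stable_fibers (@orbit_shift _ x) difference_map.
Proof.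
move=> U /lebesgue_number[e e0 eU].
have [N [c cP]] := torus_finite_net e0.
exists {ffun 'I_d -> 'I_N}, (fun p => [ffun j : 'I_d => c (coord p j)]) => p.
have /choice[A AP] n := eU (iter n (@orbit_shift _ x) p).
exists A; split=> [n|q qp cqp n]; first by have [] := AP n.
have [_] := AP n; apply => k; rewrite !coord_iter_shift.
apply: difference_map_near => // j jd; apply: cP.
by have /ffunP/(_ (Ordinal jd)) := cqp; rewrite !ffunE.
Qed.

Lemma AE_difference : AE R y = AE R x.
Proof.
have [p0 _] := tail_point x 0.
have cX := @orbit_closure_compact _ x.
apply/eqP; rewrite eq_le; apply/andP; split.
  apply: (topological_entropy_factor R cX difference_map_continuous _ _ p0).
  - exact: difference_map_surj.
  - exact: difference_map_shift.
apply: (topological_entropy_extension R cX difference_map_continuous _ _ p0).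
- exact: difference_map_surj.
- exact: difference_map_shift.
- exact: orbit_closure_hausdorff.
- exact: orbit_shift_continuous.
- exact: difference_map_fibers.
Qed.

End Difference.

Theorem theorem1p1 (R : realType) (x : nat -> torus R) (d : nat)
    (d_ge1 : (1 <= d)%N) :
  AE R (fun n : nat => x (n + d)%N - x n) = AE R x.
Proof. exact: AE_difference. Qed.
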